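(* Let $K$ be a finite set with $|K|\ge2$ and $C,C_1,D,D_1$ nonempty countable sets. Let $u\in\Delta(K\times(C\times C_1)\times(D\times D_1))$ and define $v=\mathrm{marg}_{K\times C\times(D\times D_1)}u$, $u'=\mathrm{marg}_{K\times(C\times C_1)\times D}u$, and $v'=\mathrm{marg}_{K\times C\times D}u$. Suppose that, under $u$, $(c,c_1)$ and $d$ are conditionally independent given $k$. Then $d(u',v')\le d(u,v)$.
   Context: An information structure is a probability on triples (state $k\in K$, signal of player 1, signal of player 2) with countably many signals; player 1 is the maximizer, player 2 the minimizer. In $u$ the signals are $(c,c_1)$ for player 1 and $(d,d_1)$ for player 2; in $v$ they are $c$ and $(d,d_1)$; in $u'$, $(c,c_1)$ and $d$; in $v'$, $c$ and $d$. A payoff function is a map $g:K\times I\times J\to[-1,1]$ with $I,J$ finite nonempty sets; $\mathcal G$ is the set of all payoff functions. $\mathrm{val}(u,g)$ is the value of the zero-sum Bayesian game in which the state and signals are drawn from $u$, each player learns his own signal, they simultaneously choose $i\in I$, $j\in J$ (mixed actions depending on own signal allowed), and player 1 receives $g(k,i,j)$ from player 2. $d(u,v)=\sup_{g\in\mathcal G}|\mathrm{val}(u,g)-\mathrm{val}(v,g)|$. $\mathrm{marg}$ denotes marginal distributions. *)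

(* Defs.v *)
From mathcomp Require Import all_boot all_order all_algebra.
From mathcomp Require Import all_classical all_reals all_analysis.
Set Implicit Arguments.
Unset Strict Implicit.
Unset Printing Implicit Defensive.
Import Order.TTheory GRing.Theory Num.Theory.
Local Open Scope classical_set_scope.
Local Open Scope ring_scope.

(* Discrete probabilities.  On a countable T these are the elements of
   Delta(T); they are used both for information structures and for mixed
   actions. *)
Record distr (R : realType) (T : choiceType) := Distr {
  distr_fun :> T -> R ;
  distr_ge0 : forall x, 0 <= distr_fun x ;
  distr_sum1 : \esum_(x in [set: T]) (distr_fun x)%:E = 1%E }.

Definition Pr (R : realType) (T : choiceType) (p : distr R T) (A : set T) : R :=
  fine (\esum_(x in A) (p x)%:E).

Definition condPr (R : realType) (T : choiceType) (p : distr R T)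
    (A B : set T) : R :=
  Pr p (A `&` B) / Pr p B.

(* Independence on atoms is the general notion because the variables take
   values in countable types. *)
Definition cond_indep (R : realType) (T S1 S2 S3 : countType) (p : distr R T)
    (X : T -> S1) (Y : T -> S2) (Z : T -> S3) : Prop :=
  forall x y z, 0 < Pr p (Z @^-1` [set z]) ->
    condPr p (X @^-1` [set x] `&` Y @^-1` [set y]) (Z @^-1` [set z]) =
    condPr p (X @^-1` [set x]) (Z @^-1` [set z]) *
    condPr p (Y @^-1` [set y]) (Z @^-1` [set z]).

Section Marginal.
Variables (R : realType) (T T' : choiceType) (f : T -> T') (p : distr R T).

Let pE0 x : (0 <= (p x)%:E)%E.
Proof. by rewrite lee_fin distr_ge0. Qed.

Lemma Pr_fin (A : set T) : (\esum_(x in A) (p x)%:E)%E \is a fin_num.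
Proof.
rewrite ge0_fin_numE; last exact: esum_ge0.
apply: (@le_lt_trans _ _ 1%E); last exact: ltry.
rewrite -(distr_sum1 p) (esumID A [set: T])// setTI leeDl//; exact: esum_ge0.
Qed.

Let dmap_fun (y : T') : R := Pr p (f @^-1` [set y]).

Let dmap_ge0 y : 0 <= dmap_fun y.
Proof. by rewrite fine_ge0// esum_ge0. Qed.

Let dmap_sum1 : \esum_(y in [set: T']) (dmap_fun y)%:E = 1%E.
Proof.
rewrite -(distr_sum1 p).
under eq_esum => y _ do rewrite /dmap_fun /Pr fineK ?Pr_fin//.
rewrite esum_esum//; apply/esym; apply: (@reindex_esum _ _ _ _ _ snd); split.
- by [].
- by move=> [y x] [y' x'] /set_mem[_ /= <-] /set_mem[_ /= <-] /= ->.
- by move=> x _; exists (f x, x).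
Qed.

(* The law of f under p; marginals are obtained when f is a projection. *)
Definition dmap : distr R T' := Distr dmap_ge0 dmap_sum1.

End Marginal.

(* Elements of Delta(K * S1 * S2); a point is (k, s1, s2), with s1 the signal
   of player 1 (the maximizer) and s2 the signal of player 2. *)
Definition info_structure (R : realType) (K : finType) (S1 S2 : countType) :=
  distr R (K * S1 * S2)%type.

Section Game.
Variables (R : realType) (K : finType) (S1 S2 : countType).
Variables (u : info_structure R K S1 S2) (I J : finType) (g : K -> I -> J -> R).

(* Probability that the state is k and the actions played are i and j. *)
Definition play_prob (sigma : S1 -> distr R I) (tau : S2 -> distr R J)
    (k : K) (i : I) (j : J) : R :=
  fine (\esum_(s in [set: S1 * S2])
    (u (k, s.1, s.2) * sigma s.1 i * tau s.2 j)%:E).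

(* The expectation is taken under the joint law of (k, i, j): esum is only
   meaningful for nonnegative terms, while g is signed. *)
Definition payoff (sigma : S1 -> distr R I) (tau : S2 -> distr R J) : R :=
  \sum_(k : K) \sum_(i : I) \sum_(j : J) play_prob sigma tau k i j * g k i j.

Definition maxmin : R :=
  sup [set inf [set payoff sigma tau | tau in [set: S2 -> distr R J]]
      | sigma in [set: S1 -> distr R I]].

Definition minmax : R :=
  inf [set sup [set payoff sigma tau | sigma in [set: S1 -> distr R I]]
      | tau in [set: S2 -> distr R J]].

Definition is_value (w : R) : Prop := maxmin = w /\ minmax = w.

(* The value exists for nonempty I, J and bounded g, by the minmax theorem, so
   the default 0 is then irrelevant. *)
Definition game_value : R := xget 0 [set w | is_value w].

End Game.

Definition payoff_function (R : realType) (K I J : finType)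
    (g : K -> I -> J -> R) : Prop :=
  [/\ (0 < #|I|)%N, (0 < #|J|)%N & forall k i j, -1 <= g k i j <= 1].

(* The set below is bounded by 2, so the real supremum is the right one. *)
Definition value_distance (R : realType) (K : finType) (S1 S2 S1' S2' : countType)
    (u : info_structure R K S1 S2) (v : info_structure R K S1' S2') : R :=
  sup [set r : R | exists (I J : finType) (g : K -> I -> J -> R),
    payoff_function g /\ r = `|game_value u g - game_value v g|].

(* Main.v *)
Require Import Defs.
From mathcomp Require Import all_boot all_order all_algebra.
From mathcomp Require Import all_classical all_reals all_analysis.
From mathcomp Require Import ring lra.
Import Order.TTheory GRing.Theory Num.Theory.
Local Open Scope classical_set_scope.
Local Open Scope ring_scope.
Set Implicit Arguments.
Unset Strict Implicit.
Unset Printing Implicit Defensive.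

(** Write (c, c1) for the signal of player 1 and d for the signal of player 2
in [u'].  The difference between [u'] and [v'] is the additional signal c1 of
player 1, so val(v', g) <= val(u', g): player 1 can ignore c1 (this is
[payoff_dmap] applied to a strategy reading c only).  The converse bound
val(u', g) <= val(v', g) + d(u, v) rests on the following observation.  Fix a
strategy tau of player 2, which reads d.  Given the state k, the signals of
player 1 are independent of d, hence player 1 faces in state k the mixed action
q(k, .), the average of tau over d given k, whatever she has observed.  Playing
against tau in the game g is therefore the same as solving a one-player decision
problem with payoff h(k, i) = \sum_j q(k, j) g(k, i, j), and this decision
problem only depends on the joint law of the state and of the signal of
player 1.  That law is the same in [u'] as in [u], and the same in [v'] as in
[v] ([payoff_reply_game]; the averaging is [reply], and independence enters
through [cond_indep_expect]).

Let now tau be almost optimal for player 2 in (v', g).  Then player 1 gets at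
most val(v', g) + e in the problem h with the information of [v], that is,
val(v, h) <= val(v', g) + e.  On the other hand, what player 1 can guarantee in
(u', g) she gets in particular against tau, so val(u', g) <= val(u, h) + e.
Since h, seen as a game in which player 2 has one action, is a payoff function,
val(u, h) - val(v, h) <= d(u, v), and the bound follows.

The argument uses maxmin strategies in (u', g) and minmax strategies in
(v', g), hence the existence of the value ([maxmin_eq_minmax]) for countably
many signals and finitely many actions.  This is obtained from a regret
minimization argument instead of compactness: player 1 runs regret matching
separately at each of her signals while player 2 answers each time by an almost
best response, and the average answer of player 2 holds player 1 down to
maxmin + e against all her strategies ([no_regret]).  Payoffs are shifted by 1
so that all sums over signals have nonnegative terms. *)

(** * Sums of nonnegative real families *)

Section Sums.
Variable R : realType.

(** A family is handled through its real sum, which is meaningful when the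
family is [summ]: nonnegative with a finite sum. *)
Definition ssum (T : choiceType) (f : T -> R) : R :=
  fine (\esum_(x in [set: T]) (f x)%:E).

Definition summ (T : choiceType) (f : T -> R) : Prop :=
  (forall x, 0 <= f x) /\ (\esum_(x in [set: T]) (f x)%:E < +oo)%E.

Lemma ssumK (T : choiceType) (f : T -> R) : summ f ->
  (ssum f)%:E = \esum_(x in [set: T]) (f x)%:E.
Proof.
move=> [f0 foo]; rewrite /ssum fineK// ge0_fin_numE//.
by apply: esum_ge0 => x _; rewrite lee_fin.
Qed.

Lemma ssum_of_esum (T : choiceType) (f : T -> R) (r : R) : (forall x, 0 <= f x) ->
  \esum_(x in [set: T]) (f x)%:E = r%:E -> summ f /\ ssum f = r.
Proof. by move=> f0 fr; split; [split; rewrite // fr ltry | rewrite /ssum fr]. Qed.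

Lemma eq_ssum (T : choiceType) (f g : T -> R) : f =1 g -> ssum f = ssum g.
Proof. by move=> fg; congr fine; apply: eq_esum => x _; rewrite fg. Qed.

Lemma eq_summ (T : choiceType) (f g : T -> R) : f =1 g -> summ f -> summ g.
Proof. by move=> /funext ->. Qed.

Lemma summ_le (T : choiceType) (f g : T -> R) : summ g ->
  (forall x, 0 <= f x <= g x) -> summ f.
Proof.
move=> [g0 goo] fg; split=> [x|]; first by case/andP: (fg x).
by apply: le_lt_trans goo; apply: le_esum => x _; rewrite lee_fin; case/andP: (fg x).
Qed.

Lemma ssum_ge0 (T : choiceType) (f : T -> R) : (forall x, 0 <= f x) -> 0 <= ssum f.
Proof. by move=> f0; apply/fine_ge0/esum_ge0 => x _; rewrite lee_fin. Qed.

Lemma le_ssum (T : choiceType) (f g : T -> R) : summ g ->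
  (forall x, 0 <= f x <= g x) -> ssum f <= ssum g.
Proof.
move=> sg fg; have sf := summ_le sg fg.
rewrite -lee_fin !ssumK//; apply: le_esum => x _.
by rewrite lee_fin; case/andP: (fg x).
Qed.

Lemma ssumD (T : choiceType) (f g : T -> R) : summ f -> summ g ->
  summ (fun x => f x + g x) /\ ssum (fun x => f x + g x) = ssum f + ssum g.
Proof.
move=> sf sg; have [f0 _] := sf; have [g0 _] := sg.
apply: ssum_of_esum => [x|]; first exact: addr_ge0.
by under eq_esum do rewrite EFinD; rewrite esumD// ?EFinD ?ssumK// => x _;
  rewrite lee_fin.
Qed.

Lemma esumZ (T : choiceType) (c : R) (f : T -> R) : 0 <= c -> (forall x, 0 <= f x) ->
  (\esum_(x in [set: T]) (c * f x)%:E = c%:E * \esum_(x in [set: T]) (f x)%:E)%E.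
Proof.
have le (d : R) (h : T -> R) : 0 <= d -> (forall x, 0 <= h x) ->
    (\esum_(x in [set: T]) (d * h x)%:E <= d%:E * \esum_(x in [set: T]) (h x)%:E)%E.
  move=> d0 h0; apply: ge_ereal_sup => _ [A fA <-].
  under eq_fsbigr do rewrite EFinM.
  rewrite -ge0_mule_fsumr; last by move=> x; rewrite lee_fin.
  by apply: lee_wpmul2l; [rewrite lee_fin|apply: ereal_sup_ubound; exists A].
rewrite le_eqVlt => /predU1P[<-|c0] f0.
  by rewrite mul0e esum1// => x _; rewrite mul0r.
apply/eqP; rewrite eq_le le ?(ltW c0)//=.
rewrite -lee_pdivlMl//.
have cf0 x : 0 <= c * f x by rewrite mulr_ge0// ltW.
apply: le_trans (le c^-1 (fun x => c * f x) _ cf0); last by rewrite invr_ge0 ltW.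
by apply: le_esum => x _; rewrite mulKf// gt_eqF.
Qed.

Lemma ssumZ (T : choiceType) (c : R) (f : T -> R) : 0 <= c -> summ f ->
  summ (fun x => c * f x) /\ ssum (fun x => c * f x) = c * ssum f.
Proof.
move=> c0 sf; have [f0 _] := sf.
apply: ssum_of_esum => [x|]; first exact: mulr_ge0.
by rewrite esumZ// EFinM ssumK.
Qed.

Lemma ssum_sum (T : choiceType) (I : finType) (f : I -> T -> R) :
  (forall i, summ (f i)) ->
  summ (fun x => \sum_i f i x) /\ ssum (fun x => \sum_i f i x) = \sum_i ssum (f i).
Proof.
move=> sf; apply: ssum_of_esum => [x|].
  by apply: sumr_ge0 => i _; have [] := sf i.
rewrite -sumEFin; under [RHS]eq_bigr do rewrite ssumK//.
rewrite -esum_sum; last by move=> x i _ _; rewrite lee_fin; have [] := sf i.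
by apply: eq_esum => x _; rewrite sumEFin.
Qed.

(** Fubini, from the double family to the iterated sum. *)
Lemma ssum_pair (T1 T2 : choiceType) (f : T1 * T2 -> R) : summ f ->
  [/\ forall a, summ (fun b => f (a, b)), summ (fun a => ssum (fun b => f (a, b))) &
      ssum (fun a => ssum (fun b => f (a, b))) = ssum f].
Proof.
move=> sf; have [f0 foo] := sf.
have E : (\esum_(a in [set: T1]) \esum_(b in [set: T2]) (f (a, b))%:E
          = \esum_(x in [set: T1 * T2]) (f x)%:E)%E.
  rewrite esum_esum; last by move=> i j _ _; rewrite lee_fin.
  have -> : [set: T1] `*`` (fun=> [set: T2]) = [set: T1 * T2] by apply/seteqP; split.
  by apply: eq_esum => -[].
have s1 a : summ (fun b => f (a, b)).
  split=> //; apply: le_lt_trans foo; rewrite -E.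
  rewrite (esumID [set a])//; last by move=> i _; apply: esum_ge0 => x _; rewrite lee_fin.
  rewrite setTI esum_set1; last by apply: esum_ge0 => x _; rewrite lee_fin.
  by rewrite leeDl//; apply: esum_ge0 => x _; apply: esum_ge0 => y _; rewrite lee_fin.
have [a||s2 e] := @ssum_of_esum _ (fun a => ssum (fun b => f (a, b))) (ssum f).
- exact: ssum_ge0.
- by rewrite ssumK// -E; apply: eq_esum => a _; rewrite ssumK.
- by split.
Qed.

Lemma ssum_mul (T1 T2 : choiceType) (f : T1 -> R) (g : T2 -> R) : summ f -> summ g ->
  ssum (fun x : T1 * T2 => f x.1 * g x.2) = ssum f * ssum g.
Proof.
move=> sf sg; have [f0 _] := sf; have [g0 _] := sg.
have [||_ ->//] := @ssum_of_esum _ (fun x : T1 * T2 => f x.1 * g x.2) (ssum f * ssum g).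
  by move=> x; apply: mulr_ge0.
have -> : [set: T1 * T2] = [set: T1] `*`` (fun=> [set: T2]) by apply/seteqP; split.
rewrite -(@esum_esum _ _ _ _ _ (fun a b => (f a * g b)%:E)); last first.
  by move=> i j _ _; rewrite lee_fin mulr_ge0.
rewrite mulrC EFinM (ssumK sf) -esumZ//; last exact: ssum_ge0.
by apply: eq_esum => a _; rewrite esumZ// -ssumK// mulrC EFinM.
Qed.

Lemma esum_fin (I : finType) (f : I -> R) : (forall i, 0 <= f i) ->
  \esum_(i in [set: I]) (f i)%:E = (\sum_i f i)%:E.
Proof.
move=> f0; rewrite esum_fset; [|exact: finite_finset|by move=> i _; rewrite lee_fin].
have -> : [set: I] = [set` index_enum I].
  by apply/seteqP; split => i //= _; rewrite mem_index_enum.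
by rewrite -fsbig_seq ?index_enum_uniq// sumEFin.
Qed.

End Sums.

(** * Mixed actions *)

Section FiniteDistr.
Variables (R : realType) (I : finType).

Lemma distr_fin_sum (p : distr R I) : \sum_i p i = 1.
Proof.
by have := distr_sum1 p; rewrite esum_fin; [case|exact: distr_ge0].
Qed.

Lemma distr_le1 (p : distr R I) i : p i <= 1.
Proof.
rewrite -(distr_fin_sum p) (bigD1 i)//= lerDl.
by apply: sumr_ge0 => j _; exact: distr_ge0.
Qed.

Lemma exists_distr (f : I -> R) : (forall i, 0 <= f i) -> \sum_i f i = 1 ->
  exists p : distr R I, forall i, p i = f i.
Proof.
move=> f0 f1; have f1' : \esum_(i in [set: I]) (f i)%:E = 1%E by rewrite esum_fin// f1.
by exists (Distr f0 f1').
Qed.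

Lemma exists_distr_mix (p q : distr R I) (t : R) : 0 <= t <= 1 ->
  exists r : distr R I, forall i, r i = (1 - t) * p i + t * q i.
Proof.
move=> /andP[t0 t1]; apply: exists_distr => [i|].
  by rewrite addr_ge0// mulr_ge0 ?distr_ge0// subr_ge0.
by rewrite big_split -!mulr_sumr !distr_fin_sum /=; lra.
Qed.

(** The regret-matching action: play i with a probability proportional to the
regret x i.  Then the vector of instantaneous regrets is orthogonal to x for
all payoffs l of the actions, which are thus allowed to depend on x. *)
Lemma exists_distr_orth (x : I -> R) : (0 < #|I|)%N -> (forall i, 0 <= x i) ->
  exists s : distr R I, forall l : I -> R,
    \sum_i x i * (l i - \sum_j s j * l j) = 0.
Proof.
move=> I0 x0; have [X0|X0] := eqVneq (\sum_i x i) 0.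
  have x00 i : x i = 0.
    by move/eqP: X0; rewrite psumr_eq0// => /allP/(_ i (mem_index_enum i))/eqP.
  have [s _] : exists s : distr R I, forall i, s i = #|I|%:R^-1.
    apply: exists_distr => [i|]; first by rewrite invr_ge0.
    by rewrite sumr_const -[LHS]mulr_natr mulVf// pnatr_eq0 -lt0n.
  by exists s => l; rewrite big1// => i _; rewrite x00 mul0r.
have [s sE] : exists s : distr R I, forall i, s i = x i / \sum_i x i.
  apply: exists_distr => [i|]; first by rewrite divr_ge0// sumr_ge0.
  by rewrite -mulr_suml divff.
exists s => l; under eq_bigr do rewrite mulrBr.
rewrite sumrB -mulr_suml mulr_sumr; apply/eqP; rewrite subr_eq0; apply/eqP.
by apply: eq_bigr => i _; rewrite sE mulrA; congr (_ * _); rewrite mulrC divfK.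
Qed.

Lemma strategy_nonempty (S : Type) :
  (0 < #|I|)%N -> [set: S -> distr R I] !=set0.
Proof.
by move=> I0; have [p _] := exists_distr_orth I0 (fun=> lexx 0); exists (fun=> p).
Qed.

End FiniteDistr.

(** * Regret matching with countably many signals *)

(** The abstract setting of the minmax theorem: [L y s i] is the gain of action
i at signal s against y, weighted by the probability of s (hence the bound by a
summable [b]), and the strategies y of the opponent can be mixed. *)
Section Approachability.
Variables (R : realType) (S : choiceType) (I : finType) (Y : Type).
Variables (L : Y -> S -> I -> R) (b : S -> R) (V : R).
Hypothesis I0 : (0 < #|I|)%N.
Hypothesis sb : summ b.
Hypothesis Lb : forall y s i, 0 <= L y s i <= b s.
Hypothesis mix : forall y y' (t : R), 0 <= t <= 1 ->
  exists z, forall s i, L z s i = (1 - t) * L y s i + t * L y' s i.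

Lemma avg_bounds (a : distr R I) l c : (forall i, 0 <= l i <= c) ->
  0 <= \sum_i a i * l i <= c.
Proof.
move=> lc; apply/andP; split.
  by apply: sumr_ge0 => i _; rewrite mulr_ge0 ?distr_ge0//; case/andP: (lc i).
rewrite -[leRHS]mul1r -(distr_fin_sum a) mulr_suml; apply: ler_sum => i _.
by rewrite ler_wpM2l ?distr_ge0//; case/andP: (lc i).
Qed.

Lemma summ_avg (a : S -> distr R I) y : summ (fun s => \sum_i a s i * L y s i).
Proof. by apply: summ_le sb _ => s; apply: avg_bounds. Qed.

(** Against each strategy the opponent has a reply conceding at most V. *)
Hypothesis hV : forall a : S -> distr R I,
  exists y, ssum (fun s => \sum_i a s i * L y s i) <= V.

(** The square of the positive part behaves as if it were the square: moving r
towards d only costs the cross term and the square of the step. *)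
Lemma pos_sq_mix (t r d : R) : 0 <= t <= 1 ->
  Num.max 0 ((1 - t) * r + t * d) ^+ 2 <=
  ((1 - t) * Num.max 0 r) ^+ 2 + 2 * (t * (1 - t)) * (Num.max 0 r * d) + (t * d) ^+ 2.
Proof.
move=> /andP[t0 t1]; set m := Num.max 0 r.
have -> : ((1 - t) * m) ^+ 2 + 2 * (t * (1 - t)) * (m * d) + (t * d) ^+ 2 =
   ((1 - t) * m + t * d) ^+ 2 by ring.
have rm : (1 - t) * r <= (1 - t) * m.
  by rewrite ler_wpM2l ?subr_ge0// le_max lexx orbT.
have [h|h] := leP ((1 - t) * r + t * d) 0; first by rewrite expr0n/= sqr_ge0.
by rewrite ler_sqr ?nnegrE ?lerD2r//; [exact: ltW|apply: le_trans (ltW h) _; rewrite lerD2r].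
Qed.

(** After n + 1 rounds, y is the average of the replies of the opponent and W s
the average weighted gain at signal s.  The positive part of the regret
L y s i - W s has a squared norm of order 1 / n: each round adds to the
cumulative regret a vector of norm at most sqrt(#|I|) * b s which, by the choice
of [exists_distr_orth], is orthogonal to the positive part accumulated so far. *)
Lemma approach n : exists (y : Y) (W : S -> R), [/\ forall s, 0 <= W s <= b s, ssum W <= V &
  forall s, (\sum_i Num.max 0 (L y s i - W s) ^+ 2) * n.+1%:R <= #|I|%:R * b s ^+ 2].
Proof.
have dev (a : S -> distr R I) y s i :
    (L y s i - \sum_j a s j * L y s j) ^+ 2 <= b s ^+ 2.
  have /andP[l0 l1] := Lb y s i.
  have /andP[m0 m1] := @avg_bounds (a s) (L y s) (b s) (Lb y s).
  set m := \sum_j a s j * L y s j in m0 m1 *; rewrite -[leLHS]real_normK ?num_real//.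
  rewrite ler_sqr ?nnegrE//; last exact: le_trans l1.
  rewrite ler_norml; apply/andP; split; lra.
elim: n => [|n [y [W [W0 WV yW]]]].
  have [a0 _] := strategy_nonempty R S I0.
  have [y hy] := hV a0.
  exists y, (fun s => \sum_i a0 s i * L y s i); split=> // [s|s]; first exact: avg_bounds.
  rewrite mulr1 mulr_natl -sumr_const; apply: ler_sum => i _.
  apply: le_trans (dev a0 y s i); rewrite -[leRHS]real_normK ?num_real//.
  rewrite ler_sqr ?nnegrE// ?le_max ?lexx//.
  by rewrite ge_max normr_ge0 ler_norm.
have pos0 s i : 0 <= Num.max 0 (L y s i - W s) by rewrite le_max lexx.
have [a ha] := choice (fun s => exists_distr_orth I0 (pos0 s)).
(* The reply y' to a enters the average of n + 2 rounds with weight t. *)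
have [y' hy'] := hV a.
pose t : R := n.+2%:R^-1.
have t0 : 0 < t by rewrite invr_gt0.
have t1 : t <= 1 by rewrite invf_le1// ler1n.
have t01 : 0 <= t <= 1 by rewrite ltW.
have [z hz] := mix y y' t01.
have sW : summ W by apply: summ_le sb W0.
exists z, (fun s => (1 - t) * W s + t * \sum_i a s i * L y' s i); split.
- move=> s; have /andP[? ?] := W0 s.
  have /andP[? ?] := @avg_bounds (a s) (L y' s) (b s) (Lb y' s).
  apply/andP; split; first by apply: addr_ge0; apply: mulr_ge0; rewrite // ?subr_ge0// ltW.
  have -> : b s = (1 - t) * b s + t * b s by ring.
  by rewrite lerD// ler_wpM2l// ?subr_ge0// ltW.
- have t1' : 0 <= 1 - t by rewrite subr_ge0.
  have [s1 e1] := ssumZ t1' sW.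
  have [s2 e2] := ssumZ (ltW t0) (summ_avg a y').
  have [_ ->] := ssumD s1 s2; rewrite e1 e2.
  have -> : V = (1 - t) * V + t * V by ring.
  by rewrite lerD// ler_wpM2l// ltW.
move=> s; set B := #|I|%:R * b s ^+ 2; set m := \sum_j a s j * L y' s j.
have {}ha := ha s (L y' s); have dm := dev a y' s.
rewrite -/m in ha dm; clearbody m.
have key : \sum_i Num.max 0 (L z s i - ((1 - t) * W s + t * m)) ^+ 2 <=
    (1 - t) ^+ 2 * (\sum_i Num.max 0 (L y s i - W s) ^+ 2) + t ^+ 2 * B.
  (* The cross term has sum zero by the choice of a. *)
  have -> : (1 - t) ^+ 2 * (\sum_i Num.max 0 (L y s i - W s) ^+ 2) =
    (1 - t) ^+ 2 * (\sum_i Num.max 0 (L y s i - W s) ^+ 2) +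
    2 * (t * (1 - t)) * \sum_i Num.max 0 (L y s i - W s) * (L y' s i - m).
    by rewrite ha mulr0 addr0.
  have -> : B = \sum_(i in I) b s ^+ 2 by rewrite sumr_const /B mulr_natl.
  rewrite !mulr_sumr -!big_split/=; apply: ler_sum => i _.
  have -> : L z s i - ((1 - t) * W s + t * m) =
      (1 - t) * (L y s i - W s) + t * (L y' s i - m) by rewrite hz; ring.
  apply: le_trans (pos_sq_mix _ _ t01) _.
  by rewrite !exprMn lerD2l ler_wpM2l ?sqr_ge0 ?dm.
have IH := yW s; rewrite -/B in IH.
set Q := \sum_i _ in key; set P := \sum_i _ in key IH.
have n2 : (n.+2%:R : R) = n.+1%:R + 1 by rewrite natr1.
have tn : t * (n.+1%:R + 1) = 1 by rewrite -n2 mulVf.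
have N0 : 0 < (n.+1%:R : R) by [].
rewrite n2; move: key IH tn N0; move: (n.+1%:R : R) => N.
move=> key IH tn N0.
apply: le_trans (_ : ((1 - t) ^+ 2 * P + t ^+ 2 * B) * (N + 1) <= _).
  by rewrite ler_wpM2r// addr_ge0// ltW.
have e : 1 - t = t * N by rewrite -tn; ring.
have -> : ((1 - t) ^+ 2 * P + t ^+ 2 * B) * (N + 1) = t * (t * (N + 1)) * (P * N * N + B).
  by rewrite e; ring.
rewrite tn mulr1; have : P * N * N + B <= B * N + B by rewrite lerD2r ler_wpM2r// ltW.
move/(ler_wpM2l (ltW t0)) => /le_trans; apply.
have -> : t * (B * N + B) = t * (N + 1) * B by ring.
by rewrite tn mul1r.
Qed.

(** A sublinear regret forces y to hold all strategies down to V + e. *)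
Lemma no_regret (e : R) : 0 < e ->
  exists y, forall a : S -> distr R I, ssum (fun s => \sum_i a s i * L y s i) <= V + e.
Proof.
move=> e0; have b0 : 0 <= ssum b by apply: ssum_ge0; have [] := sb.
pose d := e / (ssum b + 1).
have d0 : 0 < d by rewrite divr_gt0// ltr_wpDl.
have [n hn] : exists n : nat, #|I|%:R <= d ^+ 2 * n.+1%:R.
  exists (Num.bound (#|I|%:R / d ^+ 2)).
  rewrite mulrC -ler_pdivrMr ?exprn_gt0//; apply/ltW/(lt_trans (archi_boundP _)).
    by rewrite divr_ge0// exprn_ge0// ltW.
  by rewrite ltr_nat.
have [y [W [W0 WV yW]]] := approach n.
exists y => a; have [sb0 _] := sb.
(* From the squared norm of [approach], with n large enough for d. *)
have LW s i : L y s i <= W s + d * b s.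
  rewrite -lerBlDl; apply: le_trans (_ : Num.max 0 (L y s i - W s) <= _).
    by rewrite le_max lexx orbT.
  have db : 0 <= d * b s by rewrite mulr_ge0// ltW.
  rewrite -ler_sqr ?nnegrE ?le_max ?lexx//.
  rewrite -(ler_pM2r (ltr0Sn R n)).
  apply: le_trans (le_trans _ (yW s)) _.
    rewrite ler_wpM2r// (bigD1 i)//= lerDl; apply: sumr_ge0 => j _; exact: sqr_ge0.
  by rewrite exprMn mulrAC ler_wpM2r// sqr_ge0.
have sW : summ W by apply: summ_le sb W0.
have [s1 e1] := ssumZ (ltW d0) sb; have [s2 e2] := ssumD sW s1.
apply: le_trans (_ : ssum (fun s => W s + d * b s) <= _).
  apply: le_ssum => // s; apply: avg_bounds => i; rewrite LW andbT.
  by case/andP: (Lb y s i).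
rewrite e2 e1 lerD// -[leRHS]mulr1 /d -mulrA ler_pM2l// mulrC ler_pdivrMr ?ltr_wpDl//.
by rewrite mul1r lerDl.
Qed.

End Approachability.

(** * Expectations under a discrete probability *)

Section Exchange.
Variable R : realType.

(** Fubini, from one iterated sum to the other. *)
Lemma ssum_exchange (T1 T2 : choiceType) (f : T1 -> T2 -> R) :
  (forall a, summ (f a)) -> summ (fun a => ssum (f a)) ->
  [/\ forall b, summ (f^~ b), summ (fun b => ssum (f^~ b)) &
      ssum (fun b => ssum (f^~ b)) = ssum (fun a => ssum (f a))].
Proof.
move=> sf [_ foo].
have f0 a b : 0 <= f a b by have [] := sf a.
have E (U1 U2 : choiceType) (h : U1 -> U2 -> R) : (forall a b, 0 <= h a b) ->
    (\esum_(x in [set: U1 * U2]) (h x.1 x.2)%:E =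
     \esum_(a in [set: U1]) \esum_(b in [set: U2]) (h a b)%:E)%E.
  move=> h0; rewrite esum_esum; last by move=> i j _ _; rewrite lee_fin.
  by congr esum; apply/seteqP; split.
have sp : summ (fun x : T1 * T2 => f x.1 x.2).
  split=> //; rewrite E//; apply: le_lt_trans foo.
  by apply: le_esum => a _; rewrite ssumK.
have swap : \esum_(x in [set: T2 * T1]) (f x.2 x.1)%:E =
    \esum_(x in [set: T1 * T2]) (f x.1 x.2)%:E.
  apply/esym.
  rewrite (@reindex_esum _ _ _ [set: T2 * T1] _ (fun x => (x.2, x.1)))//.
  by split=> // [[a b] [c d] _ _ [-> ->]|[a b] _]//; exists (b, a).
have sq : summ (fun x : T2 * T1 => f x.2 x.1).
  by split=> //; rewrite swap; case: sp.
have [h1 h2 h3] := ssum_pair sq; have [g1 g2 g3] := ssum_pair sp.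
split=> //; rewrite [LHS]h3 [RHS]g3; by rewrite /ssum; congr fine.
Qed.

Lemma ssum_delta (T : choiceType) (a : T) (h : T -> R) : (forall y, 0 <= h y) ->
  summ (fun y => (a == y)%:R * h y) /\ ssum (fun y => (a == y)%:R * h y) = h a.
Proof.
move=> h0; apply: ssum_of_esum => [y|]; first exact: mulr_ge0.
transitivity (\esum_(y in [set a]) (h y)%:E).
  rewrite [RHS]esum_mkcond; apply: eq_esum => y _.
  rewrite (_ : (y \in [set a]) = (a == y)).
    by case: eqP; rewrite ?mul1r ?mul0r.
  by apply/idP/eqP => [/set_mem->|->]//; exact/mem_set.
by rewrite esum_set1// lee_fin.
Qed.

End Exchange.

Section Expectation.
Variable R : realType.

Definition expect (T : choiceType) (p : distr R T) (F : T -> R) : R :=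
  ssum (fun x => p x * F x).

Variables (T : choiceType) (p : distr R T).

Lemma summ_distr : summ p.
Proof. by split; [exact: distr_ge0|rewrite distr_sum1 ltry]. Qed.

Lemma summ_expect (F : T -> R) : (forall x, 0 <= F x <= 1) ->
  summ (fun x => p x * F x).
Proof.
move=> F01; apply: summ_le summ_distr _ => x; have /andP[F0 F1] := F01 x.
by rewrite mulr_ge0 ?distr_ge0//= ler_piMr ?distr_ge0.
Qed.

Lemma eq_expect (F G : T -> R) : F =1 G -> expect p F = expect p G.
Proof. by move=> /funext->. Qed.

Lemma expect_ge0 (F : T -> R) : (forall x, 0 <= F x) -> 0 <= expect p F.
Proof. by move=> F0; apply: ssum_ge0 => x; rewrite mulr_ge0 ?distr_ge0. Qed.

Lemma le_expect (F G : T -> R) : (forall x, 0 <= F x <= G x) ->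
  (forall x, G x <= 1) -> expect p F <= expect p G.
Proof.
move=> FG G1; apply: le_ssum => [|x].
  by apply: summ_expect => x; rewrite G1 andbT; case/andP: (FG x); exact: le_trans.
by case/andP: (FG x) => F0 ?; rewrite mulr_ge0 ?distr_ge0//= ler_wpM2l ?distr_ge0.
Qed.

Lemma expect1 : expect p (fun=> 1) = 1.
Proof.
rewrite /expect (@eq_ssum _ _ _ p); last by move=> x; rewrite mulr1.
by rewrite /ssum distr_sum1.
Qed.

Lemma expect_sum (I : finType) (F : I -> T -> R) :
  (forall i x, 0 <= F i x <= 1) ->
  expect p (fun x => \sum_i F i x) = \sum_i expect p (F i).
Proof.
move=> F01; have [_ <-] := ssum_sum (fun i => summ_expect (F01 i)).
by apply: eq_ssum => x; rewrite mulr_sumr.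
Qed.

Lemma PrE (A : set T) : Pr p A = expect p (fun x => (x \in A)%:R).
Proof.
congr fine; rewrite esum_mkcond; apply: eq_esum => x _.
by case: ifP; rewrite ?mulr1 ?mulr0.
Qed.

(** Disintegration along X, on the event A; [law] is a sub-probability. *)
Lemma ssum_law (S : choiceType) (A : pred T) (X : T -> S) (F : S -> R) :
  (forall s, 0 <= F s <= 1) ->
  let law s := expect p (fun x => (A x && (X x == s))%:R) in
  summ (fun s => law s * F s) /\
  ssum (fun s => law s * F s) = expect p (fun x => (A x)%:R * F (X x)).
Proof.
move=> F01 law.
have F0 s : 0 <= F s by case/andP: (F01 s).
pose f x s := (X x == s)%:R * (p x * ((A x)%:R * F s)).
have fE x : summ (f x) /\ ssum (f x) = p x * ((A x)%:R * F (X x)).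
  by apply: ssum_delta => s; rewrite !mulr_ge0// distr_ge0.
have s2 : summ (fun x => ssum (f x)).
  apply: (@eq_summ _ _ (fun x => p x * ((A x)%:R * F (X x)))).
    by move=> x; have [_ ->] := fE x.
  apply: summ_expect => x; case: (A x); first by rewrite mul1r.
  by rewrite mul0r lexx ler01.
have [_ g2 g3] := ssum_exchange (fun x => (fE x).1) s2.
have e s : ssum (f^~ s) = law s * F s.
  have sA : summ (fun x => p x * (A x && (X x == s))%:R).
    by apply: summ_expect => x; rewrite ler0n lern1 leq_b1.
  have [_] := ssumZ (F0 s) sA; rewrite mulrC => <-.
  by apply: eq_ssum => x; rewrite /f; case: (A x); case: (_ == _) => /=; ring.
split; first by apply: eq_summ g2 => s; rewrite e.
rewrite -(eq_ssum e) g3; apply: eq_ssum => x; exact: (fE x).2.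
Qed.

End Expectation.

Section Pushforward.
Variables (R : realType) (T T' : choiceType) (f : T -> T') (p : distr R T).

Lemma expect_dmap (F : T' -> R) : (forall y, 0 <= F y <= 1) ->
  expect (dmap f p) F = expect p (fun x => F (f x)).
Proof.
move=> F01; have [_ e] := ssum_law p predT f F01.
transitivity (expect p (fun x => (predT x)%:R * F (f x))); last first.
  by apply: eq_expect => x; rewrite mul1r.
rewrite -e; apply: eq_ssum => y /=; congr (_ * _).
rewrite /= PrE; apply: eq_expect => x; congr (_%:R).
by congr nat_of_bool; apply/idP/eqP => [/set_mem|]// h; exact/mem_set.
Qed.

End Pushforward.

(** * Conditional independence *)

Section CondIndep.
Variables (R : realType) (T S1 S2 S3 : countType) (p : distr R T).
Variables (X : T -> S1) (Y : T -> S2) (Z : T -> S3).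
Hypothesis ci : cond_indep p X Y Z.

(** On atoms this is the definition; the expectations are sums over atoms.  The
statement is free of divisions, and thus holds also for a z of probability 0. *)
Lemma cond_indep_expect z (F : S1 -> R) (G : S2 -> R) :
  (forall x, 0 <= F x <= 1) -> (forall y, 0 <= G y <= 1) ->
  expect p (fun x => (Z x == z)%:R * (F (X x) * G (Y x))) *
  expect p (fun x => (Z x == z)%:R) =
  expect p (fun x => (Z x == z)%:R * F (X x)) *
  expect p (fun x => (Z x == z)%:R * G (Y x)).
Proof.
move=> F01 G01.
pose A : pred T := fun x => Z x == z.
pose mu := expect p (fun x => (Z x == z)%:R).
pose aX s := expect p (fun x => (A x && (X x == s))%:R).
pose aY s := expect p (fun x => (A x && (Y x == s))%:R).
pose aXY s := expect p (fun x => (A x && ((X x, Y x) == s))%:R).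
have bool01 (b : bool) : 0 <= (b%:R : R) <= 1 by case: b; rewrite lexx ler01.
have le_mu (P : T -> bool) : expect p (fun x => (A x && P x)%:R) <= mu.
  apply: le_expect => x; last by rewrite lern1 leq_b1.
  by rewrite ler0n ler_nat /A; case: (Z x == z); rewrite ?leq_b1.
have law_ge0 (P : T -> bool) : 0 <= expect p (fun x => (A x && P x)%:R).
  exact: expect_ge0.
have fac s : aXY s * mu = aX s.1 * aY s.2.
  have [mu0|mu0] := eqVneq mu 0.
    have z0 P : expect p (fun x => (A x && P x)%:R) = 0.
      by apply/eqP; rewrite eq_le law_ge0 -mu0 le_mu.
    by rewrite mu0 mulr0 [aX _]z0 mul0r.
  have PZ : Pr p (Z @^-1` [set z]) = mu.
    rewrite PrE; apply: eq_expect => x; congr (nat_of_bool _)%:R.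
    by apply/idP/eqP => [/set_mem|h]//; exact/mem_set.
  have mupos : 0 < mu by rewrite lt_neqAle eq_sym mu0 expect_ge0.
  have := ci s.1 s.2; rewrite -PZ in mupos => /(_ _ mupos).
  rewrite /condPr PZ.
  have -> : Pr p (X @^-1` [set s.1] `&` Y @^-1` [set s.2] `&` Z @^-1` [set z]) = aXY s.
    rewrite PrE; apply: eq_expect => x; congr (nat_of_bool _)%:R.
    apply/idP/andP => [/set_mem[[/= h1 h2] h3]|[/eqP h1 /eqP h2]].
      by rewrite /A h3 h1 h2 -surjective_pairing !eqxx.
    by apply/mem_set; rewrite -h2.
  have -> : Pr p (X @^-1` [set s.1] `&` Z @^-1` [set z]) = aX s.1.
    rewrite PrE; apply: eq_expect => x; congr (nat_of_bool _)%:R.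
    apply/idP/andP => [/set_mem[/= h1 h2]|[/eqP h1 /eqP h2]].
      by rewrite /A h1 h2 !eqxx.
    exact/mem_set.
  have -> : Pr p (Y @^-1` [set s.2] `&` Z @^-1` [set z]) = aY s.2.
    rewrite PrE; apply: eq_expect => x; congr (nat_of_bool _)%:R.
    apply/idP/andP => [/set_mem[/= h1 h2]|[/eqP h1 /eqP h2]].
      by rewrite /A h1 h2 !eqxx.
    exact/mem_set.
  move=> h; have -> : aXY s = aXY s / mu * mu by rewrite divfK.
  by rewrite h; field.
have FG01 s : 0 <= F s.1 * G s.2 <= 1.
  have /andP[? ?] := F01 s.1; have /andP[? ?] := G01 s.2.
  by rewrite mulr_ge0//= mulr_ile1.
have [sXY eXY] := ssum_law p A (fun x => (X x, Y x)) FG01.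
have [sX eX] := ssum_law p A X F01.
have [sY eY] := ssum_law p A Y G01.
rewrite -[X in X * _ = _]eXY -[X in _ = X * _]eX -[X in _ = _ * X]eY.
rewrite -(ssum_mul sX sY) mulrC.
have [_ <-] := ssumZ (expect_ge0 p (fun x => ler0n R (Z x == z))) sXY.
by apply: eq_ssum => s; rewrite mulrA [_ * aXY s]mulrC fac /aX /aY; ring.
Qed.

End CondIndep.

(** * Existence and characterization of the value *)

Section Game.
Variables (R : realType) (K : finType) (S1 S2 : countType).
Variables (u : info_structure R K S1 S2) (I J : finType).

Lemma play_probE (sigma : S1 -> distr R I) (tau : S2 -> distr R J) k i j :
  play_prob u sigma tau k i j =
  expect u (fun x => (x.1.1 == k)%:R * (sigma x.1.2 i * tau x.2 j)).
Proof.
congr fine; apply/esym.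
transitivity (\esum_(x in [set x : K * S1 * S2 | x.1.1 = k])
    (u x * sigma x.1.2 i * tau x.2 j)%:E).
  rewrite [RHS]esum_mkcond; apply: eq_esum => x _.
  rewrite (_ : (x \in _) = (x.1.1 == k)); last first.
    by apply/idP/eqP => [/set_mem|h]//; exact/mem_set.
  by case: eqP => _; rewrite ?mul1r ?mul0r ?mulr0// mulrA.
apply: (@reindex_esum _ _ _ [set: S1 * S2] _ (fun s => (k, s.1, s.2))); split.
- by move=> s _.
- by move=> [a b] [c d] _ _ [-> ->].
- by move=> [[k' a] b] /= ->; exists (a, b).
Qed.

Lemma play_prob_ge0 (sigma : S1 -> distr R I) (tau : S2 -> distr R J) k i j :
  0 <= play_prob u sigma tau k i j.
Proof. by rewrite play_probE expect_ge0// => x; rewrite !mulr_ge0 ?distr_ge0. Qed.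

Lemma play_prob_total (sigma : S1 -> distr R I) (tau : S2 -> distr R J) :
  \sum_k \sum_i \sum_j play_prob u sigma tau k i j = 1.
Proof.
have sumJ k i (x : K * S1 * S2) : \sum_j ((x.1.1 == k)%:R * (sigma x.1.2 i * tau x.2 j)) =
    (x.1.1 == k)%:R * sigma x.1.2 i :> R.
  by rewrite -!mulr_sumr distr_fin_sum mulr1.
have sumI k (x : K * S1 * S2) :
    \sum_i ((x.1.1 == k)%:R * sigma x.1.2 i) = (x.1.1 == k)%:R :> R.
  by rewrite -mulr_sumr distr_fin_sum mulr1.
have b01 (b : bool) : 0 <= (b%:R : R) <= 1 by case: b; rewrite lexx ler01.
have p01 (x y : R) : 0 <= x <= 1 -> 0 <= y <= 1 -> 0 <= x * y <= 1.
  by move=> /andP[? ?] /andP[? ?]; rewrite mulr_ge0//= mulr_ile1.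
have d01 (L : finType) (d : distr R L) l : 0 <= d l <= 1.
  by rewrite distr_ge0 distr_le1.
rewrite -(expect1 u).
transitivity (expect u (fun x => \sum_k (x.1.1 == k)%:R)); last first.
  apply: eq_expect => x; rewrite (bigD1 x.1.1)//= eqxx big1 ?addr0// => k.
  by rewrite eq_sym => /negbTE->.
rewrite expect_sum//; apply: eq_bigr => k _.
rewrite -(eq_expect u (sumI k)) expect_sum; last by move=> i x; apply: p01.
apply: eq_bigr => i _; rewrite -(eq_expect u (sumJ k i)) expect_sum//.
  by apply: eq_bigr => j _; rewrite play_probE.
by move=> j x; rewrite !p01.
Qed.

Variable g : K -> I -> J -> R.
Hypothesis gP : payoff_function g.

Let gb k i j : 0 <= 1 + g k i j <= 2.
Proof. by have [_ _ /(_ k i j) /andP[? ?]] := gP; apply/andP; split; lra. Qed.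

Lemma payoff_shift (sigma : S1 -> distr R I) (tau : S2 -> distr R J) :
  1 + payoff u g sigma tau =
  \sum_k \sum_i \sum_j (1 + g k i j) * play_prob u sigma tau k i j.
Proof.
rewrite -[X in X + _](play_prob_total sigma tau) /payoff -big_split; apply: eq_bigr => k _.
rewrite -big_split; apply: eq_bigr => i _; rewrite -big_split; apply: eq_bigr => j _.
by rewrite /=; ring.
Qed.

Lemma payoff_bound (sigma : S1 -> distr R I) (tau : S2 -> distr R J) :
  -1 <= payoff u g sigma tau <= 1.
Proof.
have h1 : 0 <= 1 + payoff u g sigma tau.
  rewrite payoff_shift; apply: sumr_ge0 => k _; apply: sumr_ge0 => i _.
  apply: sumr_ge0 => j _; rewrite mulr_ge0 ?play_prob_ge0//.
  by case/andP: (gb k i j).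
have h2 : 1 + payoff u g sigma tau <= 2.
  rewrite payoff_shift -[leRHS]mulr1 -[X in _ <= _ * X](play_prob_total sigma tau).
  rewrite mulr_sumr; apply: ler_sum => k _; rewrite mulr_sumr; apply: ler_sum => i _.
  rewrite mulr_sumr; apply: ler_sum => j _; rewrite ler_wpM2r ?play_prob_ge0//.
  by case/andP: (gb k i j).
by apply/andP; split; lra.
Qed.

Let sigma0 : [set: S1 -> distr R I] !=set0.
Proof. by have [I0 _ _] := gP; exact: strategy_nonempty. Qed.

Let tau0 : [set: S2 -> distr R J] !=set0.
Proof. by have [_ J0 _] := gP; exact: strategy_nonempty. Qed.

Let guar1 sigma := [set payoff u g sigma tau | tau in [set: S2 -> distr R J]].
Let guar2 tau := [set payoff u g sigma tau | sigma in [set: S1 -> distr R I]].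

Let inf1_lb sigma tau : inf (guar1 sigma) <= payoff u g sigma tau.
Proof.
apply: ge_inf; last by exists tau.
by exists (-1) => _ [t _ <-]; case/andP: (payoff_bound sigma t).
Qed.

Let sup2_ub sigma tau : payoff u g sigma tau <= sup (guar2 tau).
Proof.
apply: ub_le_sup; last by exists sigma.
by exists 1 => _ [s _ <-]; case/andP: (payoff_bound s tau).
Qed.

Lemma le_maxmin c sigma : (forall tau, c <= payoff u g sigma tau) -> c <= maxmin u g.
Proof.
move=> h; have [tau _] := tau0.
apply: (@le_trans _ _ (inf (guar1 sigma))).
  by apply: lb_le_inf => [|_ [t _ <-]//]; exists (payoff u g sigma tau); exists tau.
apply: ub_le_sup; last by exists sigma.
exists 1 => _ [s _ <-]; apply: le_trans (inf1_lb s tau) _.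
by case/andP: (payoff_bound s tau).
Qed.

Lemma ge_minmax c tau : (forall sigma, payoff u g sigma tau <= c) -> minmax u g <= c.
Proof.
move=> h; have [sigma _] := sigma0.
apply: (@le_trans _ _ (sup (guar2 tau))); last first.
  by apply: ge_sup => [|_ [t _ <-]//]; exists (payoff u g sigma tau); exists sigma.
apply: ge_inf; last by exists tau.
exists (-1) => _ [t _ <-]; apply: le_trans (sup2_ub sigma t).
by case/andP: (payoff_bound sigma t).
Qed.

Lemma maxmin_adherent e : 0 < e ->
  exists sigma, forall tau, maxmin u g - e < payoff u g sigma tau.
Proof.
move=> e0; have [sigma _] := sigma0; have [tau _] := tau0.
have hs : has_sup [set inf (guar1 s) | s in [set: S1 -> distr R I]].
  split; first by exists (inf (guar1 sigma)); exists sigma.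
  exists 1 => _ [s _ <-]; apply: le_trans (inf1_lb s tau) _.
  by case/andP: (payoff_bound s tau).
have [_ [s _ <-] h] := sup_adherent e0 hs.
by exists s => t; exact: lt_le_trans h (inf1_lb s t).
Qed.

Lemma minmax_adherent e : 0 < e ->
  exists tau, forall sigma, payoff u g sigma tau < minmax u g + e.
Proof.
move=> e0; have [sigma _] := sigma0; have [tau _] := tau0.
have hs : has_inf [set sup (guar2 t) | t in [set: S2 -> distr R J]].
  split; first by exists (sup (guar2 tau)); exists tau.
  exists (-1) => _ [t _ <-]; apply: le_trans (sup2_ub sigma t).
  by case/andP: (payoff_bound sigma t).
have [_ [t _ <-] h] := inf_adherent e0 hs.
by exists t => s; exact: le_lt_trans (sup2_ub s t) h.
Qed.

Lemma maxmin_response e sigma : 0 < e ->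
  exists tau, payoff u g sigma tau <= maxmin u g + e.
Proof.
move=> e0; apply: contrapT => /forallNP h.
have : maxmin u g + e <= maxmin u g.
  by apply: (@le_maxmin _ sigma) => tau; apply/ltW; rewrite ltNge; apply/negP/h.
by rewrite gerDl leNgt e0.
Qed.

(** The shifted payoff of action i at signal s, weighted by the probability of s. *)
Let gain (tau : S2 -> distr R J) s i : R :=
  \sum_k \sum_j (1 + g k i j) * ssum (fun s2 => u (k, s, s2) * tau s2 j).
(** Twice the probability of s, as shifted payoffs lie in [0, 2]. *)
Let mass s : R := \sum_k 2 * ssum (fun s2 => u (k, s, s2)).

Let summ_slice k : [/\ forall s, summ (fun s2 => u (k, s, s2)) ,
   summ (fun s : S1 * S2 => u (k, s.1, s.2)) &
   summ (fun s => ssum (fun s2 => u (k, s, s2)))].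
Proof.
have [h1 h2 _] := ssum_pair (summ_distr u).
have hk : summ (fun s : S1 * S2 => u (k, s.1, s.2)).
  split=> [s|]; first exact: distr_ge0.
  apply: le_lt_trans (summ_distr u).2.
  rewrite -(@esum_image _ _ _ [set: S1 * S2] (fun s => (k, s.1, s.2)) (fun x => (u x)%:E)).
    rewrite esum_mkcond; apply: le_esum => x _.
    by case: ifP; rewrite // lee_fin distr_ge0.
  by move=> [a b] [c d] _ _ [-> ->].
by have [g1 g2 _] := ssum_pair hk; split.
Qed.

Let summ_mass : summ mass.
Proof.
apply: (ssum_sum _).1 => k; have [_ _ h] := summ_slice k.
by apply: (ssumZ _ h).1.
Qed.

Let summ_tau (tau : S2 -> distr R J) k s j : summ (fun s2 => u (k, s, s2) * tau s2 j).
Proof.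
have [h _ _] := summ_slice k; apply: summ_le (h s) _ => s2.
by rewrite mulr_ge0 ?distr_ge0//= ler_piMr ?distr_ge0 ?distr_le1.
Qed.

Let gain_bound tau s i : 0 <= gain tau s i <= mass s.
Proof.
have nn k j : 0 <= ssum (fun s2 => u (k, s, s2) * tau s2 j).
  by apply: ssum_ge0 => s2; rewrite mulr_ge0 ?distr_ge0.
apply/andP; split.
  apply: sumr_ge0 => k _; apply: sumr_ge0 => j _; rewrite mulr_ge0//.
  by case/andP: (gb k i j).
apply: ler_sum => k _.
have -> : ssum (fun s2 => u (k, s, s2)) =
    \sum_j ssum (fun s2 => u (k, s, s2) * tau s2 j).
  have [_ <-] := ssum_sum (summ_tau tau k s).
  by apply: eq_ssum => s2; rewrite -mulr_sumr distr_fin_sum mulr1.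
rewrite mulr_sumr; apply: ler_sum => j _; rewrite ler_wpM2r//.
by case/andP: (gb k i j).
Qed.

Let gain_mix tau tau' (t : R) : 0 <= t <= 1 ->
  exists tau'', forall s i, gain tau'' s i = (1 - t) * gain tau s i + t * gain tau' s i.
Proof.
move=> t01; have [r hr] := choice (fun s2 => exists_distr_mix (tau s2) (tau' s2) t01).
have /andP[t0 t1] := t01; have t1' : 0 <= 1 - t by rewrite subr_ge0.
exists r => s i; rewrite !mulr_sumr -big_split; apply: eq_bigr => k _.
rewrite !mulr_sumr -big_split; apply: eq_bigr => j _ /=.
have [a1 e1] := ssumZ t1' (summ_tau tau k s j).
have [a2 e2] := ssumZ t0 (summ_tau tau' k s j).
rewrite (@eq_ssum _ _ _ (fun s2 => (1 - t) * (u (k, s, s2) * tau s2 j) +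
   t * (u (k, s, s2) * tau' s2 j))); last by move=> s2; rewrite hr; ring.
by have [_ ->] := ssumD a1 a2; rewrite e1 e2; ring.
Qed.

Let gainE (sigma : S1 -> distr R I) tau :
  ssum (fun s => \sum_i sigma s i * gain tau s i) = 1 + payoff u g sigma tau.
Proof.
pose w k i j s := (1 + g k i j) * (sigma s i * ssum (fun s2 => u (k, s, s2) * tau s2 j)).
have hw k i j : summ (w k i j) /\
    ssum (w k i j) = (1 + g k i j) * play_prob u sigma tau k i j.
  have gk : 0 <= 1 + g k i j by case/andP: (gb k i j).
  have sp : summ (fun s : S1 * S2 => u (k, s.1, s.2) * sigma s.1 i * tau s.2 j).
    have [_ h _] := summ_slice k; apply: summ_le h _ => s.
    rewrite !mulr_ge0 ?distr_ge0//= -mulrA ler_piMr ?distr_ge0//.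
    by rewrite mulr_ile1 ?distr_ge0 ?distr_le1.
  have [p1 p2 p3] := ssum_pair sp.
  have E s : ssum (fun s2 => u (k, s, s2) * sigma s i * tau s2 j) =
      sigma s i * ssum (fun s2 => u (k, s, s2) * tau s2 j).
    have [_ <-] := ssumZ (distr_ge0 (sigma s) i) (summ_tau tau k s j).
    by apply: eq_ssum => s2; ring.
  have p2' := eq_summ E p2.
  have [q1 q2] := ssumZ gk p2'; split=> //.
  rewrite q2; congr (_ * _); rewrite -(eq_ssum E); exact: p3.
rewrite payoff_shift.
have s1 k i := ssum_sum (fun j => (hw k i j).1).
have s2 k := ssum_sum (fun i => (s1 k i).1).
have s3 := ssum_sum (fun k => (s2 k).1).
transitivity (ssum (fun s => \sum_k \sum_i \sum_j w k i j s)).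
  apply: eq_ssum => s; rewrite exchange_big/=; apply: eq_bigr => i _.
  rewrite /gain mulr_sumr; apply: eq_bigr => k _; rewrite mulr_sumr.
  by apply: eq_bigr => j _; rewrite /w; ring.
rewrite s3.2; apply: eq_bigr => k _; rewrite (s2 k).2; apply: eq_bigr => i _.
by rewrite (s1 k i).2; apply: eq_bigr => j _; rewrite (hw k i j).2.
Qed.

(** Weak duality for one inequality; for the other, [no_regret] applied to the
shifted payoff, the reply of player 2 to each strategy being almost optimal. *)
Lemma maxmin_eq_minmax : maxmin u g = minmax u g.
Proof.
apply/eqP; rewrite eq_le; apply/andP; split.
  apply/ler_addgt0Pr => e e0.
  have e2 : 0 < e / 2 by rewrite divr_gt0.
  have [s hs] := maxmin_adherent e2; have [t ht] := minmax_adherent e2.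
  by have := hs t; have := ht s; lra.
apply/ler_addgt0Pr => e e0.
have e2 : 0 < e / 2 by rewrite divr_gt0.
have [I0 _ _] := gP.
have hV (a : S1 -> distr R I) :
    exists tau, ssum (fun s => \sum_i a s i * gain tau s i) <= 1 + maxmin u g + e / 2.
  have [tau h] := maxmin_response a e2; exists tau; rewrite gainE; lra.
have [tau h] := no_regret I0 summ_mass gain_bound gain_mix hV e2.
by apply: (@ge_minmax _ tau) => s; have := h s; rewrite gainE; lra.
Qed.

Lemma game_valueE : game_value u g = maxmin u g.
Proof.
apply: xget_unique; first by split; rewrite // maxmin_eq_minmax.
by move=> w [].
Qed.

Lemma le_game_value c sigma : (forall tau, c <= payoff u g sigma tau) ->
  c <= game_value u g.
Proof. by rewrite game_valueE; exact: le_maxmin. Qed.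

Lemma ge_game_value c tau : (forall sigma, payoff u g sigma tau <= c) ->
  game_value u g <= c.
Proof. by rewrite game_valueE maxmin_eq_minmax; exact: ge_minmax. Qed.

Lemma game_value_guarantee e : 0 < e ->
  exists sigma, forall tau, game_value u g - e < payoff u g sigma tau.
Proof. by rewrite game_valueE; exact: maxmin_adherent. Qed.

Lemma game_value_defend e : 0 < e ->
  exists tau, forall sigma, payoff u g sigma tau < game_value u g + e.
Proof. by rewrite game_valueE maxmin_eq_minmax; exact: minmax_adherent. Qed.

Lemma game_value_bound : -1 <= game_value u g <= 1.
Proof.
have [s _] := sigma0; have [t _] := tau0; apply/andP; split.
  by apply: (@le_game_value _ s) => t'; case/andP: (payoff_bound s t').
by apply: (@ge_game_value _ t) => s'; case/andP: (payoff_bound s' t).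
Qed.

End Game.

(** * Distance between information structures *)

(** Payoffs in images of [p] become expectations under [p] itself, so
that they can be compared. *)
Lemma payoff_dmap (R : realType) (K : finType) (T S1 S2 : countType) (p : distr R T)
    (f : T -> K * S1 * S2) (I J : finType) (g : K -> I -> J -> R)
    (sigma : S1 -> distr R I) (tau : S2 -> distr R J) :
  payoff (dmap f p : info_structure R K S1 S2) g sigma tau =
  \sum_k \sum_i \sum_j expect p (fun x => ((f x).1.1 == k)%:R *
     (sigma (f x).1.2 i * tau (f x).2 j)) * g k i j.
Proof.
apply: eq_bigr => k _; apply: eq_bigr => i _; apply: eq_bigr => j _; congr (_ * _).
rewrite play_probE expect_dmap// => x.
by rewrite !mulr_ge0 ?distr_ge0//= !mulr_ile1 ?mulr_ge0 ?distr_ge0 ?distr_le1// lern1 leq_b1.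
Qed.

Section Distance.
Variables (R : realType) (K : finType) (S1 S2 S1' S2' : countType).
Variables (u : info_structure R K S1 S2) (v : info_structure R K S1' S2').

Lemma ge_value_distance (I J : finType) (g : K -> I -> J -> R) : payoff_function g ->
  `|game_value u g - game_value v g| <= value_distance u v.
Proof.
move=> gP; apply: ub_le_sup; last by exists I, J, g.
exists 2 => _ [I' [J' [g' [g'P ->]]]].
have /andP[? ?] := game_value_bound u g'P; have /andP[? ?] := game_value_bound v g'P.
by rewrite ler_norml; apply/andP; split; lra.
Qed.

Lemma le_value_distance c :
  (forall (I J : finType) (g : K -> I -> J -> R), payoff_function g ->
    `|game_value u g - game_value v g| <= c) -> value_distance u v <= c.
Proof.
move=> h; apply: ge_sup => [|_ [I [J [g [gP ->]]]]]; last exact: h.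
exists `|game_value u (fun _ (_ _ : unit) => 0) - game_value v (fun _ (_ _ : unit) => 0)|.
exists unit, unit, (fun _ _ _ => 0); split=> //.
by split=> [||k i j]; rewrite ?card_unit// lerN10 ler01.
Qed.

End Distance.

(** * The decision problem faced by player 1 against a fixed strategy *)

Section Reply.
Variables (R : realType) (K : finType) (C C1 D D1 : countType).
Variable u : info_structure R K (C * C1)%type (D * D1)%type.
Hypothesis hci : cond_indep u (fun x => x.1.2) (fun x => x.2.1) (fun x => x.1.1).
Variables (I J : finType) (tau : D -> distr R J).

Definition state_mass k : R := expect u (fun x => (x.1.1 == k)%:R).

(** The law of the action of player 2 given the state k, when she plays [tau];
it is 0 at a state of probability 0. *)
Definition reply k j : R :=
  expect u (fun x => (x.1.1 == k)%:R * tau x.2.1 j) / state_mass k.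

(** A one-player problem is encoded as a game in which player 2 has one action. *)
Definition reply_game (g : K -> I -> J -> R) (k : K) (i : I) (_ : unit) : R :=
  \sum_j reply k j * g k i j.

Lemma reply_ge0 k j : 0 <= reply k j.
Proof.
by apply: divr_ge0; apply: expect_ge0 => x; rewrite ?mulr_ge0 ?distr_ge0.
Qed.

Lemma sum_reply_le1 k : \sum_j reply k j <= 1.
Proof.
rewrite -mulr_suml -expect_sum; last first.
  by move=> j x; rewrite mulr_ge0 ?distr_ge0//= mulr_ile1 ?distr_ge0 ?distr_le1 ?lern1 ?leq_b1.
have -> : expect u (fun x => \sum_j (x.1.1 == k)%:R * tau x.2.1 j) = state_mass k.
  by apply: eq_expect => x; rewrite -mulr_sumr distr_fin_sum mulr1.
by have [->|h] := eqVneq (state_mass k) 0; [rewrite mul0r|rewrite divff].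
Qed.

Lemma reply_game_payoff g : payoff_function g -> payoff_function (reply_game g).
Proof.
move=> [I0 _ gb]; split; rewrite ?card_unit// => k i j; rewrite /reply_game {j}.
rewrite -ler_norml; apply: le_trans (ler_norm_sum _ _ _) _.
apply: le_trans (sum_reply_le1 k); apply: ler_sum => j _.
rewrite normrM ger0_norm ?reply_ge0// ler_piMr ?reply_ge0// ler_norml; exact: gb.
Qed.

(** Given the state, the action of player 2 is independent of all that player 1
does; this is where conditional independence is used. *)
Lemma expect_reply (F : C * C1 -> R) k j : (forall x, 0 <= F x <= 1) ->
  expect u (fun x => (x.1.1 == k)%:R * (F x.1.2 * tau x.2.1 j)) =
  reply k j * expect u (fun x => (x.1.1 == k)%:R * F x.1.2).
Proof.
move=> F01; have G01 d : 0 <= tau d j <= 1 by rewrite distr_ge0 distr_le1.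
have ci := cond_indep_expect hci k F01 G01.
have [m0|m0] := eqVneq (state_mass k) 0; last first.
  by rewrite /reply mulrAC [X in _ = X / _]mulrC -ci mulfK.
rewrite /reply m0 invr0 mulr0 mul0r; apply/eqP; rewrite eq_le; apply/andP; split.
  rewrite -m0; apply: le_expect => x; last by rewrite lern1 leq_b1.
  have /andP[? ?] := F01 x.1.2; have /andP[? ?] := G01 x.2.1.
  by rewrite !mulr_ge0//= ler_piMr// mulr_ile1.
apply: expect_ge0 => x; have /andP[? ?] := F01 x.1.2; have /andP[? ?] := G01 x.2.1.
by rewrite !mulr_ge0.
Qed.

(** Since the decision problem leaves player 2 no choice, it can be posed with
any signal rho (d, d1) of player 2: this is how the comparison of structures
without d1 is moved to structures with d1.  The map pi covers the two signals
(c, c1) and c of player 1. *)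
Lemma payoff_reply_game (S : countType) (pi : C * C1 -> S) (E : countType)
    (rho : (D * D1)%type -> E) g (sigma : S -> distr R I) (one : E -> distr R unit) :
  payoff (dmap (fun x => (x.1.1, pi x.1.2, x.2.1)) u : info_structure R K S D)
    g sigma tau =
  payoff (dmap (fun x => (x.1.1, pi x.1.2, rho x.2)) u : info_structure R K S E)
    (reply_game g) sigma one.
Proof.
rewrite !payoff_dmap; apply: eq_bigr => k _; apply: eq_bigr => i _ /=.
rewrite (big_pred1 tt) /=; last by case.
have F01 x : 0 <= sigma (pi x) i <= 1 by rewrite distr_ge0 distr_le1.
rewrite /reply_game mulr_sumr; apply: eq_bigr => j _.
rewrite (expect_reply k j F01) mulrA; congr (_ * _); rewrite mulrC; congr (_ * _).
apply: eq_expect => x; congr (_ * _).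
by have := distr_fin_sum (one (rho x.2)); rewrite (big_pred1 tt) => [->|[]//]; rewrite mulr1.
Qed.

End Reply.

Lemma dmap_id (R : realType) (T : choiceType) (p : distr R T) : dmap id p =1 p.
Proof.
move=> x; rewrite /= /Pr (_ : id @^-1` [set x] = [set x])// esum_set1//.
by rewrite lee_fin distr_ge0.
Qed.

Lemma eq_payoff (R : realType) (K : finType) (S1 S2 : countType)
    (u w : info_structure R K S1 S2) (I J : finType) (g : K -> I -> J -> R) sigma tau :
  u =1 w -> payoff u g sigma tau = payoff w g sigma tau.
Proof.
move=> uw; apply: eq_bigr => k _; apply: eq_bigr => i _; apply: eq_bigr => j _.
by congr (_ * _); congr fine; apply: eq_esum => s _; rewrite uw.
Qed.

Unset Implicit Arguments.
Set Strict Implicit.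

Theorem proposition4 (R : realType) (K : finType) (C C1 D D1 : countType)
    (hK : (2 <= #|K|)%N)
    (hC : [set: C] !=set0) (hC1 : [set: C1] !=set0)
    (hD : [set: D] !=set0) (hD1 : [set: D1] !=set0)
    (u : info_structure R K (C * C1)%type (D * D1)%type)
    (v : info_structure R K C (D * D1)%type)
    (u' : info_structure R K (C * C1)%type D)
    (v' : info_structure R K C D)
    (hv : v = dmap (fun x => (x.1.1, x.1.2.1, x.2)) u)
    (hu' : u' = dmap (fun x => (x.1.1, x.1.2, x.2.1)) u)
    (hv' : v' = dmap (fun x => (x.1.1, x.1.2.1, x.2.1)) u)
    (hci : cond_indep u (fun x => x.1.2) (fun x => x.2.1) (fun x => x.1.1)) :
  value_distance u' v' <= value_distance u v.
Proof.
apply: le_value_distance => I J g gP.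
have mono : game_value v' g <= game_value u' g.
  apply/ler_addgt0Pr => e e0; rewrite -lerBlDr.
  have [s hs] := game_value_guarantee v' gP e0.
  apply: (@le_game_value _ _ _ _ u' _ _ _ gP _ (fun c => s c.1)) => t.
  have := hs t; rewrite hu' hv' !payoff_dmap; exact: ltW.
rewrite ger0_norm ?subr_ge0//.
apply/ler_addgt0Pr => e e0.
have e2 : 0 < e / 2 by rewrite divr_gt0.
have [tau ht] := game_value_defend v' gP e2.
have hP := reply_game_payoff u tau gP.
set h := reply_game u tau g in hP.
have [one _] : [set: D * D1 -> distr R unit] !=set0.
  by apply: strategy_nonempty; rewrite card_unit.
(* An almost optimal strategy of (u', g) is used in the problem h. *)
have hi : game_value u' g - e / 2 <= game_value u h.
  have [s hs] := game_value_guarantee u' gP e2.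
  apply: (le_game_value hP (sigma := s)) => o; apply: ltW.
  have -> : payoff u h s o = payoff u' g s tau; last exact: hs.
  rewrite hu' (payoff_reply_game hci tau id id g s o).
  apply: eq_payoff => x; rewrite -[LHS]dmap_id.
  by congr (dmap _ u x); apply/funext => -[[]].
(* The optimality of tau in (v', g) bounds what player 1 gets in h with c only. *)
have lo : game_value v h <= game_value v' g + e / 2.
  apply: (ge_game_value hP (tau := one)) => s; apply: ltW.
  have -> : payoff v h s one = payoff v' g s tau; last exact: ht.
  by rewrite hv' hv (payoff_reply_game hci tau fst id g s one).
have := ge_value_distance u v hP; have := ler_norm (game_value u h - game_value v h).
move: hi lo; lra.
Qed.
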